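(* Let $A\in\mathbb{R}^{m\times n}$, $b\in\mathbb{R}^m$, $c\in\mathbb{R}^n$, $l\in\mathbb{R}^n$ with all entries positive, and let $r$ be an integer with $0<r\le n$. Consider the Lagrangian dual problem $\max_{y\in\mathbb{R}^m}\theta(y)$ of the sparse linear program $(\mathcal{P})$, where $\theta(y):=\min_{x\in C(l;r)}\left\{c^Tx-y^T(Ax-b)\right\}$. This dual problem can be explicitly formulated as the unconstrained convex program $$(\mathcal{D})\qquad \max_{y\in\mathbb{R}^m}\ b^Ty-\left\|\Pi_{S(r)\cap\mathbb{R}^n_+}\bigl(l\circ(A^Ty-c)\bigr)\right\|_1 ,$$ that is, for every $y\in\mathbb{R}^m$, $\theta(y)=b^Ty-\|\Pi_{S(r)\cap\mathbb{R}^n_+}(l\circ(A^Ty-c))\|_1$, and the maximized function is concave in $y$.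
   Context: The sparse linear program is $(\mathcal{P})$: $\min c^Tx$ subject to $Ax=b$, $0\le x\le l$ (entrywise), $\|x\|_0\le r$, where $\|x\|_0$ is the number of nonzero entries of $x$. The feasible region of $(\mathcal{P})$ is assumed nonempty. Notation: $\mathbb{R}^n_+$ is the set of entrywise nonnegative vectors; $S(r)=\{x\in\mathbb{R}^n:\|x\|_0\le r\}$; $C(l;r)=\{x\in\mathbb{R}^n: 0\le x\le l,\ x\in S(r)\}$; $\circ$ is the entrywise (Hadamard) product; $\|\cdot\|_1$ is the $\ell_1$ norm. For a closed set $\Omega\subseteq\mathbb{R}^n$, $\Pi_\Omega(z)=\arg\min_{y\in\Omega}\|z-y\|^2$ (Euclidean norm), possibly set-valued. All elements of $\Pi_{S(r)\cap\mathbb{R}^n_+}(z)$ have the same $\ell_1$ norm, and $\|\Pi_{S(r)\cap\mathbb{R}^n_+}(z)\|_1$ denotes this common value; it equals the sum of the $r$ largest entries of $[z]_+=\max\{z,0\}$ (entrywise). *)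

(* Defs.v *)
From HB Require Import structures.
From mathcomp Require Import all_boot all_order all_algebra.
From mathcomp Require Import boolp classical_sets reals convex.

Set Implicit Arguments.
Unset Strict Implicit.
Unset Printing Implicit Defensive.

Import Order.TTheory GRing.Theory Num.Theory.

Local Open Scope classical_set_scope.
Local Open Scope ring_scope.

Section Vectors.
Context {R : realType}.

Definition dotv n (u v : 'cV[R]_n) : R := (u^T *m v) 0 0.

Definition l0norm n (x : 'cV[R]_n) : nat := #|[pred i | x i 0 != 0]|.

Definition l1norm n (x : 'cV[R]_n) : R := \sum_i `|x i 0|.

(* The library norm on matrices is the sup norm, hence this separate
   squared Euclidean norm. *)
Definition sql2norm n (x : 'cV[R]_n) : R := \sum_i x i 0 ^+ 2.

Definition hadamard n (u v : 'cV[R]_n) : 'cV[R]_n := map2_mx *%R u v.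

Definition orthant n : set 'cV[R]_n := [set x : 'cV[R]_n | forall i, 0 <= x i 0].

Definition sparse n (r : nat) : set 'cV[R]_n := [set x : 'cV[R]_n | (l0norm x <= r)%N].

Definition sparse_box n (l : 'cV[R]_n) (r : nat) : set 'cV[R]_n :=
  [set x : 'cV[R]_n | (forall i, 0 <= x i 0 <= l i 0) /\ sparse r x].

Definition eproj n (Omega : set 'cV[R]_n) (z : 'cV[R]_n) : set 'cV[R]_n :=
  [set p : 'cV[R]_n | Omega p /\ forall y, Omega y -> sql2norm (z - p) <= sql2norm (z - y)].

(* The common l1 norm of all the elements of [eproj Omega z]; it is the junk
   value 0 when that set is empty or its elements have different norms. *)
Definition eproj_l1norm n (Omega : set 'cV[R]_n) (z : 'cV[R]_n) : R :=
  xget 0 [set v | @l1norm n @` eproj Omega z = [set v]].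

Definition is_min (V : set R) (v : R) : Prop := V v /\ lbound V v.

End Vectors.

Section SparseLP.
Context {R : realType} {m n : nat}.
Variables (A : 'M[R]_(m, n)) (b : 'cV[R]_m) (c l : 'cV[R]_n) (r : nat).

Definition feasible : set 'cV[R]_n :=
  [set x : 'cV[R]_n | A *m x = b /\ sparse_box l r x].

Definition lagrangian (x : 'cV[R]_n) (y : 'cV[R]_m) : R :=
  dotv c x - dotv y (A *m x - b).

Definition lagrangian_values (y : 'cV[R]_m) : set R :=
  [set lagrangian x y | x in sparse_box l r].

(* [inf] is the minimum as soon as the latter is attained. *)
Definition theta (y : 'cV[R]_m) : R := inf (lagrangian_values y).

Definition dual_objective (y : 'cV[R]_m) : R :=
  dotv b y
  - eproj_l1norm (sparse r `&` @orthant R n) (hadamard l (A^T *m y - c)).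

End SparseLP.

(* Main.v *)
(** A linear function [g^T x] on the sparse box is bounded by the sum, over the
    support of [x], of the entries of [u = [l o g]_+], hence by the sum of the
    [r] largest entries of [u]; taking [x = l] at the positive ones among these
    indices attains it.  On the other side, completing the square shows that a
    sparse nonnegative vector with support [S] is at squared distance at least
    [|z|^2 - \sum_(i in S) [z]_+ i ^+ 2] from [z], with equality only for the
    restriction of [[z]_+] to [S]; so the projections are the restrictions of
    [[z]_+] to the supports maximizing the sum of squares, and the sum of the
    entries is the same on all of these supports.  Finally, [theta] is concave
    as a minimum of functions that are affine in [y]. *)
Require Import Defs.
From mathcomp Require Import all_boot all_order all_algebra.
From mathcomp Require Import boolp classical_sets reals convex interval_inference.
From mathcomp Require Import ring lra.

Set Implicit Arguments.
Unset Strict Implicit.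
Unset Printing Implicit Defensive.

Import Order.TTheory GRing.Theory Num.Theory.

Local Open Scope classical_set_scope.
Local Open Scope ring_scope.

(** * Sums over the largest entries of a finite family *)

Section TopSubsets.
Context {K : realDomainType} {T : finType}.
Implicit Types (u f : T -> K) (D S : {set T}).

(** Exchange argument: [D] maximizes the sum of [u] among the sets of cardinal [r] and [k] minimizes
    [u] on [D]; swapping [k] for an outside [i] cannot increase the sum. The value [u k] then serves
    as a threshold. *)
Lemma exists_top_subset u r : (0 < r <= #|T|)%N ->
  exists D k, [/\ #|D| = r, k \in D, forall i, i \in D -> u k <= u i
                & forall i, i \notin D -> u i <= u k].
Proof.
move=> /andP[r_gt0 r_le].
(* Any set of cardinal [r] will do: it only shows that the maximum is taken over a nonempty
   family. *)
pose D0 := [set x in take r (enum T)].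
have D0P : #|D0| == r.
  rewrite cardsE; apply/eqP.
  have /card_uniqP -> : uniq (take r (enum T)) by rewrite take_uniq ?enum_uniq.
  by rewrite size_takel // -cardT.
case: (@arg_maxP _ _ _ D0 (fun D => #|D| == r) (fun D => \sum_(i in D) u i) D0P).
move=> D /eqP cardD maxD.
have /card_gt0P[k0 k0D] : (0 < #|D|)%N by rewrite cardD.
case: (@arg_minP _ _ _ k0 (mem D) u k0D) => k kD mink.
exists D, k; split=> // i iND.
have /maxD : #|i |: (D :\ k)| == r.
  rewrite cardsU1 !inE (negbTE iND) andbF /=.
  by rewrite -cardD (cardsD1 k D) [k \in D]kD.
rewrite big_setU1 ?(big_setD1 k kD) /= ?lerD2r //.
by rewrite !inE (negbTE iND) andbF.
Qed.

(** The common part of [D] and [S] cancels, and [t] is subtracted from each remaining term. If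
    [t >= 0] separates the values on [D] from those outside and [S] is no larger than [D], all three
    terms on the right are nonnegative. *)
Lemma sum_subset_diff f D S t :
  \sum_(i in D) f i - \sum_(i in S) f i =
    \sum_(i in D :\: S) (f i - t) + \sum_(i in S :\: D) (t - f i)
      + t * (#|D|%:R - #|S|%:R).
Proof.
rewrite (big_setID S) [X in _ - X](big_setID D) /= [S :&: D]finset.setIC !sumrB.
rewrite !sumr_const -[in RHS](cardsID S D) -[in RHS](cardsID D S).
rewrite [S :&: D]finset.setIC !natrD -[t *+ #|D :\: S|]mulr_natr.
rewrite -[t *+ #|S :\: D|]mulr_natr; ring.
Qed.

Lemma sum_top_subset_max f D S t : 0 <= t -> (#|S| <= #|D|)%N ->
    (forall i, i \in D -> t <= f i) -> (forall i, i \notin D -> f i <= t) ->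
  \sum_(i in S) f i <= \sum_(i in D) f i.
Proof.
move=> t_ge0 leSD geD leDC; rewrite -subr_ge0 (sum_subset_diff f D S t).
rewrite !addr_ge0 ?mulr_ge0 ?subr_ge0 ?ler_nat //.
  by apply: sumr_ge0 => i /finset.setDP[/geD]; rewrite subr_ge0.
by apply: sumr_ge0 => i /finset.setDP[_ /leDC]; rewrite subr_ge0.
Qed.

(* Equality of the sums of squares forces [u] to take the threshold value [t]
   on the symmetric difference of [S] and [D]. *)
Lemma sum_top_subset_sqr u D S t :
    0 <= t -> (forall i, 0 <= u i) -> (#|S| <= #|D|)%N ->
    (forall i, i \in D -> t <= u i) -> (forall i, i \notin D -> u i <= t) ->
    \sum_(i in S) u i ^+ 2 = \sum_(i in D) u i ^+ 2 ->
  \sum_(i in S) u i = \sum_(i in D) u i.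
Proof.
move=> t_ge0 u_ge0 leSD geD leDC /esym/eqP.
rewrite -subr_eq0 (sum_subset_diff _ D S (t ^+ 2)).
have geD2 i : i \in D :\: S -> 0 <= u i ^+ 2 - t ^+ 2.
  by case/finset.setDP=> /geD; rewrite subr_ge0 ler_sqr ?nnegrE.
have leDC2 i : i \in S :\: D -> 0 <= t ^+ 2 - u i ^+ 2.
  by case/finset.setDP=> _ /leDC; rewrite subr_ge0 ler_sqr ?nnegrE.
rewrite !paddr_eq0 ?addr_ge0 ?mulr_ge0 ?sqr_ge0 ?subr_ge0 ?ler_nat ?sumr_ge0 //.
rewrite !psumr_eq0 // => /andP[/andP[/allP eqD /allP eqS] eqC].
apply/esym/eqP; rewrite -subr_eq0 (sum_subset_diff _ D S t).
rewrite !big1 ?add0r.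
(* The cardinality term for the squares has factor [t ^+ 2] instead of [t]; both factors vanish
   together. *)
- by move: eqC; rewrite !mulf_eq0 orbb.
- move=> i iSD; have := eqS i (mem_index_enum i); rewrite iSD /=.
  by rewrite subr_eq0 eqrXn2 // => /eqP ->; rewrite subrr.
- move=> i iDS; have := eqD i (mem_index_enum i); rewrite iDS /=.
  by rewrite subr_eq0 eqrXn2 // => /eqP ->; rewrite subrr.
Qed.

End TopSubsets.

(** * Projections onto the sparse nonnegative vectors *)

Section Projection.
Context {R : realType} {n : nat}.
Implicit Types (x y z : 'cV[R]_n) (D : {set 'I_n}).

Definition supp x : {set 'I_n} := [set i | x i 0 != 0].

Definition pos_part z i : R := Num.max (z i 0) 0.

Lemma card_supp x : #|supp x| = l0norm x.
Proof. by rewrite cardsE. Qed.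

Lemma supp_out x i : i \notin supp x -> x i 0 = 0.
Proof. by rewrite inE negbK => /eqP. Qed.

Lemma pos_part_ge0 z i : 0 <= pos_part z i.
Proof. by rewrite le_max lexx orbT. Qed.

Lemma pos_part_ge z i : z i 0 <= pos_part z i.
Proof. by rewrite le_max lexx. Qed.

Lemma mul_pos_part z i : z i 0 * pos_part z i = pos_part z i ^+ 2.
Proof. by rewrite /pos_part; case: leP; rewrite ?expr2 ?mulr0. Qed.

Definition pos_restr z D : 'cV[R]_n :=
  \col_i if i \in D then pos_part z i else 0.

Lemma pos_restr_sparse_orthant z D r : (#|D| <= r)%N ->
  (sparse r `&` @orthant R n) (pos_restr z D).
Proof.
move=> Dr; split=> [|i]; last by rewrite mxE; case: ifP; rewrite ?pos_part_ge0.
rewrite /sparse /= -card_supp (leq_trans _ Dr) //; apply/subset_leq_card.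
by apply/fintype.subsetP=> i; rewrite inE mxE; case: ifP => //; rewrite eqxx.
Qed.

Lemma sql2norm_pos_restr z D :
  sql2norm (z - pos_restr z D) = sql2norm z - \sum_(i in D) pos_part z i ^+ 2.
Proof.
rewrite /sql2norm [X in _ = _ - X]big_mkcond -sumrB; apply: eq_bigr => i _.
rewrite !mxE; case: ifP => _; last by rewrite !subr0.
by rewrite sqrrB mul_pos_part; ring.
Qed.

(** Contribution of coordinate [i] to the excess of the squared distance from [z] to [x] over that
    from [z] to [pos_restr z (supp x)]. *)
Definition square_gap z x i : R :=
  if i \in supp x then (z i 0 - x i 0) ^+ 2 - z i 0 ^+ 2 + pos_part z i ^+ 2
  else 0.

Lemma sql2norm_sub_gap z x :
  sql2norm (z - x) = sql2norm z - \sum_(i in supp x) pos_part z i ^+ 2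
                     + \sum_i square_gap z x i.
Proof.
rewrite /sql2norm [X in _ = _ - X + _]big_mkcond -sumrB -big_split.
apply: eq_bigr => i _; rewrite !mxE /square_gap /=.
by case: ifPn => [_|/supp_out ->]; ring.
Qed.

(** For [x] in the orthant both terms are nonnegative, and the square vanishes only if [x] agrees
    with [pos_part z] at [i]. *)
Lemma square_gapE z x i : i \in supp x ->
  square_gap z x i =
    (x i 0 - pos_part z i) ^+ 2 + 2 * x i 0 * (pos_part z i - z i 0).
Proof. by move=> ix; rewrite /square_gap ix; ring. Qed.

Lemma square_gap_ge0 z x i : orthant x -> 0 <= square_gap z x i.
Proof.
move=> x_ge0; have [ix|/negbTE ix] := boolP (i \in supp x); last first.
  by rewrite /square_gap ix.
rewrite square_gapE // addr_ge0 ?sqr_ge0 // mulr_ge0 ?mulr_ge0 //.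
by rewrite subr_ge0 pos_part_ge.
Qed.

Lemma square_gap_eq0 z x i : orthant x -> i \in supp x ->
  square_gap z x i = 0 -> x i 0 = pos_part z i.
Proof.
move=> x_ge0 ix /eqP; rewrite square_gapE // paddr_eq0 ?sqr_ge0 //.
  by case/andP; rewrite sqrf_eq0 subr_eq0 => /eqP.
by rewrite mulr_ge0 ?mulr_ge0 ?subr_ge0 ?pos_part_ge.
Qed.

Lemma l1norm_supp x : orthant x -> l1norm x = \sum_(i in supp x) x i 0.
Proof.
move=> x_ge0; rewrite /l1norm [RHS]big_mkcond; apply: eq_bigr => i _.
by rewrite ger0_norm //; case: ifPn => // /supp_out.
Qed.

(** Equality with a singleton gives at once that a projection exists and that all projections share
    one l1 norm. *)
Lemma image_l1norm_eproj z D t : 0 <= t ->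
    (forall i, i \in D -> t <= pos_part z i) ->
    (forall i, i \notin D -> pos_part z i <= t) ->
  @l1norm R n @` eproj (sparse #|D| `&` @orthant R n) z
    = [set \sum_(i in D) pos_part z i].
Proof.
move=> t_ge0 geD leDC; set Omega := _ `&` _.
have supp_max x : Omega x ->
    \sum_(i in supp x) pos_part z i ^+ 2 <= \sum_(i in D) pos_part z i ^+ 2.
  move=> [x_sparse _]; apply: (sum_top_subset_max (sqr_ge0 t)).
  - by rewrite card_supp.
  - by move=> i /geD; rewrite ler_sqr ?nnegrE ?pos_part_ge0.
  - by move=> i /leDC; rewrite ler_sqr ?nnegrE ?pos_part_ge0.
have gap_sum_ge0 x : Omega x -> 0 <= \sum_i square_gap z x i.
  by move=> [_ x_ge0]; apply: sumr_ge0 => i _; exact: square_gap_ge0.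
have restrO : Omega (pos_restr z D) by exact: pos_restr_sparse_orthant.
have proj_l1 p : eproj Omega z p -> l1norm p = \sum_(i in D) pos_part z i.
  move=> [pO /(_ _ restrO)]; rewrite sql2norm_pos_restr sql2norm_sub_gap => p_opt.
  have pmax := supp_max _ pO; have pgap := gap_sum_ge0 _ pO.
  (* Optimality against [pos_restr z D] bounds the gap sum by the sum of squares over [supp p] minus
     that over [D], which is nonpositive by [pmax]. With [gap0], the same inequalities make the two
     sums of squares equal. *)
  have gap0 : \sum_i square_gap z p i = 0 by lra.
  have [p_sparse p_ge0] := pO.
  have p_pos i : i \in supp p -> p i 0 = pos_part z i.
    move=> ip; apply: square_gap_eq0 => //.
    by apply: (psumr_eq0P _ gap0) => // j _; exact: square_gap_ge0.
  rewrite l1norm_supp // (eq_bigr _ p_pos).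
  apply: (sum_top_subset_sqr t_ge0) => //; first exact: pos_part_ge0.
    by rewrite card_supp.
  lra.
have restr_proj : eproj Omega z (pos_restr z D).
  split=> // x xO; rewrite sql2norm_pos_restr sql2norm_sub_gap.
  have := supp_max _ xO; have := gap_sum_ge0 _ xO; lra.
apply/seteqP; split=> [_ [p /proj_l1 -> <-]//|_ ->].
by exists (pos_restr z D) => //; exact: proj_l1.
Qed.

End Projection.

(** * Values determined by an attained minimum or by a singleton *)

Section MinInf.
Context {R : realType}.

Lemma is_min_inf (V : set R) v : is_min V v -> inf V = v.
Proof.
move=> [Vv lbv]; apply/eqP; rewrite eq_le; apply/andP; split.
  by apply: ge_inf => //; exists v.
by apply: lb_le_inf => //; exists v.
Qed.

Lemma eproj_l1norm_eq n (Omega : set 'cV[R]_n) z v :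
  @l1norm R n @` eproj Omega z = [set v] -> eproj_l1norm Omega z = v.
Proof.
move=> Ev; rewrite /eproj_l1norm; apply: xget_unique => // w Ew.
by have : [set w] v by rewrite -Ew Ev.
Qed.

End MinInf.

(** * The inner minimization of the Lagrangian *)

Section Dual.
Context {R : realType} {m n : nat}.
Variables (A : 'M[R]_(m, n)) (b : 'cV[R]_m) (c l : 'cV[R]_n).
Implicit Types (x : 'cV[R]_n) (y : 'cV[R]_m).

Lemma dotvE k (u v : 'cV[R]_k) : dotv u v = \sum_i u i 0 * v i 0.
Proof. by rewrite /dotv mxE; apply: eq_bigr => i _; rewrite mxE. Qed.

Lemma dotvC k (u v : 'cV[R]_k) : dotv u v = dotv v u.
Proof. by rewrite !dotvE; apply: eq_bigr => i _; rewrite mulrC. Qed.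

(** Collecting the terms in [x] reduces the inner minimization to maximizing a linear form over the
    sparse box. *)
Lemma lagrangianE x y :
  lagrangian A b c x y = dotv b y - dotv (A^T *m y - c) x.
Proof.
rewrite /lagrangian [dotv b y]dotvC /dotv mulmxBr [(_ - c)^T]linearB /= mulmxBl.
rewrite trmx_mul trmxK mulmxA.
rewrite ![fun_of_matrix (_ - _) _ _]mxE ![fun_of_matrix (- _) _ _]mxE; ring.
Qed.

(** The weights add up to 1, so the part [dotv c x], constant in the multiplier, is preserved. *)
Lemma lagrangian_conv x y1 y2 (s : R) :
  lagrangian A b c x (s *: y1 + (1 - s) *: y2) =
    s * lagrangian A b c x y1 + (1 - s) * lagrangian A b c x y2.
Proof.
rewrite /lagrangian /dotv [(_ + _)^T]linearD /= ![(_ *: _)^T]linearZ mulmxDl -!scalemxAl.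
rewrite ![fun_of_matrix (_ + _ *: _) _ _]mxE ![fun_of_matrix (_ *: _) _ _]mxE; ring.
Qed.

Hypothesis l_gt0 : forall i, 0 < l i 0.

Lemma dotv_box_le x g : (forall i, 0 <= x i 0 <= l i 0) ->
  dotv g x <= \sum_(i in supp x) pos_part (hadamard l g) i.
Proof.
move=> xl; rewrite dotvE [leRHS]big_mkcond; apply: ler_sum => i _.
have /andP[x_ge0 x_le] := xl i.
case: ifPn => [_|/supp_out ->]; last by rewrite mulr0.
rewrite /pos_part mxE le_max; have [g_ge0|g_lt0] := leP 0 (g i 0).
  by rewrite [l i 0 * _]mulrC ler_wpM2l.
by rewrite mulr_le0_ge0 ?orbT // ltW.
Qed.

Lemma dotv_box_attained g (D : {set 'I_n}) : exists2 x,
  sparse_box l #|D| x & dotv g x = \sum_(i in D) pos_part (hadamard l g) i.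
Proof.
exists (\col_i if (i \in D) && (0 < g i 0) then l i 0 else 0); last first.
  rewrite dotvE [RHS]big_mkcond; apply: eq_bigr => i _; rewrite /pos_part !mxE.
  case: (i \in D) => /=; last by rewrite mulr0.
  have [g_gt0|g_le0] := ltP 0 (g i 0).
    by rewrite max_l 1?mulrC // mulr_ge0 ?ltW.
  by rewrite mulr0 max_r // mulr_ge0_le0 // ltW.
split=> [i|]; first by rewrite mxE; case: ifP; rewrite ?lexx ltW.
rewrite /sparse /= -card_supp; apply/subset_leq_card/fintype.subsetP=> i.
by rewrite inE mxE; case: (i \in D) => //; rewrite eqxx.
Qed.

(** The hypotheses on [D] and [t] are those of [image_l1norm_eproj], so a single top subset yields
    both the minimum and the norm of the projections. *)
Lemma lagrangian_is_min y (D : {set 'I_n}) t : 0 <= t ->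
    (forall i, i \in D -> t <= pos_part (hadamard l (A^T *m y - c)) i) ->
    (forall i, i \notin D -> pos_part (hadamard l (A^T *m y - c)) i <= t) ->
  is_min (lagrangian_values A b c l #|D| y)
    (dotv b y - \sum_(i in D) pos_part (hadamard l (A^T *m y - c)) i).
Proof.
move=> t_ge0 geD leDC; split.
  have [x xC xE] := dotv_box_attained (A^T *m y - c) D.
  by exists x => //; rewrite lagrangianE xE.
move=> _ [x [xl x_sparse] <-]; rewrite lagrangianE lerD2l lerN2.
apply: (le_trans (dotv_box_le _ xl)).
by apply: (sum_top_subset_max t_ge0) => //; rewrite card_supp.
Qed.

End Dual.

Theorem theorem2p5 (R : realType) (m n : nat)
    (A : 'M[R]_(m, n)) (b : 'cV[R]_m) (c l : 'cV[R]_n) (r : nat)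
    (l_gt0 : forall i, 0 < l i 0) (r_gt0 : (0 < r)%N) (r_le_n : (r <= n)%N)
    (feas : feasible A b l r !=set0) :
  [/\ forall y : 'cV[R]_m,
        is_min (lagrangian_values A b c l r y) (theta A b c l r y),
      forall y : 'cV[R]_m,
        let Omega := sparse r `&` @orthant R n in
        let z := hadamard l (A^T *m y - c) in
        @l1norm R n @` eproj Omega z = [set eproj_l1norm Omega z],
      forall y : 'cV[R]_m, theta A b c l r y = dual_objective A b c l r y
    & convex_function [set: convex_lmodType 'cV[R]_m]
        (fun y : convex_lmodType 'cV[R]_m => - dual_objective A b c l r y)].
Proof.
have dual y :
    is_min (lagrangian_values A b c l r y) (dual_objective A b c l r y) /\
    let z := hadamard l (A^T *m y - c) in
    let Omega := sparse r `&` @orthant R n in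
    @l1norm R n @` eproj Omega z = [set eproj_l1norm Omega z].
  set z := hadamard l (A^T *m y - c).
  have [|D [k [cardD _ geD leDC]]] := @exists_top_subset _ _ (pos_part z) r.
    by rewrite card_ord r_gt0.
  have t_ge0 := pos_part_ge0 z k.
  have E := image_l1norm_eproj t_ge0 geD leDC.
  rewrite /dual_objective -/z -cardD (eproj_l1norm_eq E).
  by split=> //; exact: lagrangian_is_min t_ge0 geD leDC.
have thetaE y : theta A b c l r y = dual_objective A b c l r y.
  by rewrite /theta; apply: is_min_inf; case: (dual y).
split=> // [y|y|s y1 y2 _ _]; [|by case: (dual y)|].
  by rewrite thetaE; case: (dual y).
(* Concavity: a minimizer [x] at the convex combination is a competitor at [y1] and at [y2], and the
   Lagrangian at this fixed [x] is affine in the multiplier. *)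
have [[[x xC]+ _] _] := dual (s%:num *: y1 + (1 - s%:num) *: y2 : 'cV[R]_m).
have [[_ lb1] _] := dual y1; have [[_ lb2] _] := dual y2.
have {}lb1 := lb1 _ (imageP _ xC); have {}lb2 := lb2 _ (imageP _ xC).
rewrite lagrangian_conv => /esym dualE; rewrite [leLHS](congr1 -%R dualE).
rewrite [leRHS]convRE /unstable.onem opprD -!mulrN.
by rewrite lerD // ler_wpM2l ?subr_ge0 ?lerN2.
Qed.
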